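(* Let $\Omega\subset\mathbb{C}$ be a convex bounded domain, and let $\{p_n(z)\}_{n=0}^\infty$ be a sequence of univariate polynomials with complex coefficients, with degrees $m_n=\deg p_n$, such that $\lim_{n\to\infty} m_n=+\infty$. Let $\sharp_n(\Omega)$ denote the number of zeros of $p_n$ lying in $\Omega$, counted with multiplicities, and assume that $$\lim_{n\to\infty}\frac{\sharp_n(\Omega)}{m_n}=1.$$ Then for every $\epsilon>0$, $$\lim_{n\to\infty}\frac{\sharp_n'(\Omega_\epsilon)}{m_n-1}=1,$$ where $\Omega_\epsilon$ is the open $\epsilon$-neighborhood of $\Omega$ in $\mathbb{C}$ and $\sharp_n'(\Omega_\epsilon)$ is the number of zeros of the derivative $p_n'$ lying in $\Omega_\epsilon$, counted with multiplicities.
   Context: A domain is a nonempty open connected subset of $\mathbb{C}$. The open $\epsilon$-neighborhood of $\Omega$ is $\Omega_\epsilon=\{z\in\mathbb{C}:\ \mathrm{dist}(z,\Omega)<\epsilon\}$, with the Euclidean distance. *)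

(* Defs.v *)
From HB Require Import structures.
From mathcomp Require Import all_boot all_order all_algebra.
From mathcomp Require Import all_classical all_reals all_analysis.
From mathcomp Require Import complex.

Set Implicit Arguments.
Unset Strict Implicit.
Unset Printing Implicit Defensive.

Import Order.TTheory GRing.Theory Num.Theory.
Import numFieldNormedType.Exports.

Local Open Scope classical_set_scope.
Local Open Scope ring_scope.
Local Open Scope complex_scope.

(* R[i] itself has no topology in scope; R[i]^o is the same type with the
   topology of the norm `|x|. *)
Definition domain (R : realType) (A : set R[i]^o) : Prop :=
  [/\ A !=set0, open A & connected A].

(* Rcomplex R is R[i] seen as a vector space over R (whereas R[i]^o is one over
   R[i]), so the weights of the convex combinations are real. *)
Definition convex (R : realType) (A : set R[i]^o) : Prop :=
  convex_set (M := Rcomplex R) A.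

(* The norm of Rcomplex R is the modulus with values in R; that of R[i] has
   values in R[i]. *)
Definition modulus (R : realType) (z : R[i]) : R := `|(z : Rcomplex R)|.

(* Meaningful for A nonempty, as inf set0 = 0. *)
Definition dist (R : realType) (z : R[i]) (A : set R[i]^o) : R :=
  inf [set modulus (z - w) | w in A].

Definition neighborhood (R : realType) (A : set R[i]^o) (e : R) : set R[i]^o :=
  [set z | dist z A < e].

(* 0 for p = 0. *)
Definition degree (R : realType) (p : {poly R[i]}) : nat := (size p).-1.

(* Finitely supported sum of the root multiplicities, mup z p being 0 when z is
   not a root of p. For p = 0, all the mup z p are 0. *)
Definition nzeros (R : realType) (A : set R[i]^o) (p : {poly R[i]}) : nat :=
  \big[addn/0%N]_(z \in A) mup z p.

(* Main.v *)
Require Import Defs.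
From HB Require Import structures.
From mathcomp Require Import all_boot all_order all_algebra.
From mathcomp Require Import all_classical all_reals all_analysis.
From mathcomp Require Import complex.
From mathcomp Require Import polyrcf ring lra.

Set Implicit Arguments.
Unset Strict Implicit.
Unset Printing Implicit Defensive.

Import Order.TTheory GRing.Theory Num.Theory.
Import numFieldNormedType.Exports.

Local Open Scope classical_set_scope.
Local Open Scope ring_scope.
Local Open Scope complex_scope.

(* Once the zeros in a closed disc are most of the zeros of p, only o(deg p)
   critical points lie outside a slightly larger disc; a convex bounded Omega
   lies in finitely many discs whose slight enlargements intersect inside the
   e-neighborhood of Omega. For the unit disc, write
   p = q r with q collecting the n zeros in the disc and r the other k = o(n).
   - In the variable w = 1/z, q becomes a polynomial Q without zeros in
     |w| < 1, and p'/q is of size at most deg p * C^k * prod |b|, b ranging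
     over the zeros of r.
   - Near infinity p' is conversely at least c * C^-k * prod |b| * |q| at some
     point: by the maximum principle |r(z1)| >= |r(0)| = prod |b| for some z1
     of given large modulus; from z1/4 to z1 each factor of q at least doubles,
     so |p| at least doubles, and the mean value inequality bounds |p'| below
     between these two points.
   - Jensen's inequality, that is the maximum principle for p'/q multiplied by
     inverse Blaschke factors, converts this into lam^J <= C m C^k, lam > 1,
     for the number J of far critical points. *)

(** * The modulus, and the maximum principle for polynomials *)

Section Modulus.
Variable R : realType.
Implicit Types (z w : R[i]) (x : R).

Lemma modulusE z : (modulus z)%:C = `|z|.
Proof. by []. Qed.

Lemma modulus_ge0 z : 0 <= modulus z.
Proof. exact: normr_ge0. Qed.

Lemma modulus0 : modulus (0 : R[i]) = 0.
Proof. exact: Normc.normc0. Qed.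

Lemma modulus1 : modulus (1 : R[i]) = 1.
Proof. exact: Normc.normc1. Qed.

Lemma modulus_gt0 z : (0 < modulus z) = (z != 0).
Proof. exact: normr_gt0. Qed.

Lemma modulusM z w : modulus (z * w) = modulus z * modulus w.
Proof. exact: Normc.normcM. Qed.

Lemma modulusV z : modulus z^-1 = (modulus z)^-1.
Proof. exact: Normc.normcV. Qed.

Lemma modulusN z : modulus (- z) = modulus z.
Proof. exact: normrN. Qed.

Lemma modulusB z w : modulus (z - w) = modulus (w - z).
Proof. by rewrite -modulusN opprB. Qed.

Lemma modulusD z w : modulus (z + w) <= modulus z + modulus w.
Proof. exact: ler_normD. Qed.

Lemma modulus_subD z w : modulus (z - w) <= modulus z + modulus w.
Proof. by rewrite -(modulusN w) modulusD. Qed.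

Lemma modulus_ge_sub z w : modulus z - modulus w <= modulus (z - w).
Proof. by rewrite lerBlDr -{1}(subrK w z) modulusD. Qed.

Lemma modulusX z n : modulus (z ^+ n) = modulus z ^+ n.
Proof.
by elim: n => [|n IHn]; rewrite ?modulus1 // !exprS modulusM IHn.
Qed.

Lemma modulus_prod (I : Type) (s : seq I) (F : I -> R[i]) :
  modulus (\prod_(i <- s) F i) = \prod_(i <- s) modulus (F i).
Proof. exact: (big_morph _ modulusM modulus1). Qed.

Lemma modulus_real x : modulus x%:C = `|x|.
Proof. by rewrite /modulus /Num.norm /= expr0n addr0 sqrtr_sqr. Qed.

Lemma modulus_nat n : modulus (n%:R : R[i]) = n%:R.
Proof. by rewrite -(rmorph_nat (real_complex R)) modulus_real normr_nat. Qed.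

Lemma modulus_conj z : modulus z^*%C = modulus z.
Proof. by case: z => a b; rewrite /modulus /Num.norm /= sqrrN. Qed.

Lemma mulr_conj z : z * z^*%C = (modulus z ^+ 2)%:C.
Proof. by rewrite -sqr_normc -modulusE rmorphXn. Qed.

Lemma Re_le_modulus z : `|complex.Re z| <= modulus z.
Proof. by rewrite -lecR modulusE normc_ge_Re. Qed.

(* The even part [E] satisfies [P(w) + P(-w) = 2 E(w^2)], so that the degree can
   be halved. *)
Lemma max_modulus0 (P : {poly R[i]}) (rho : R) : 0 <= rho ->
  exists2 w, modulus w = rho & modulus P.[0] <= modulus P.[w].
Proof.
have [n le_Pn] := ubnP (size P).
elim: n P rho le_Pn => // n IHn P rho le_Pn rho0.
have [P1 | P1] := leqP (size P) 1.
  exists rho%:C; first by rewrite modulus_real ger0_norm.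
  by rewrite (size1_polyC P1) !hornerC.
have [|| v v_rho le_v] := IHn (even_poly P) (rho ^+ 2).
- apply: leq_ltn_trans (size_even_poly P) _.
  rewrite -ltnS; apply: leq_trans le_Pn; rewrite ltnS.
  case: (size P) P1 => [|[|m]] // _.
  by rewrite ltn_uphalf_double !doubleS !ltnS -addnn leq_addr.
- exact: exprn_ge0.
have E0 : (even_poly P).[0] = P.[0].
  by rewrite !horner_coef0 coef_even_poly.
set w := sqrtc v.
have w2 : w ^+ 2 = v by exact: sqr_sqrtc.
have w_rho : modulus w = rho.
  apply/eqP; rewrite -(@eqrXn2 _ 2) ?modulus_ge0 //.
  by rewrite -modulusX w2 v_rho.
have Pw u : P.[u] = (even_poly P).[u ^+ 2] + (odd_poly P).[u ^+ 2] * u.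
  by rewrite -{1}(poly_even_odd P) !hornerE !horner_comp !hornerE.
have sumP : P.[w] + P.[- w] = (even_poly P).[v] *+ 2.
  by rewrite !Pw sqrrN w2 mulrN addrACA subrr addr0 mulr2n.
have [le_w | lt_w] := lerP (modulus P.[0]) (modulus P.[w]); first by exists w.
exists (- w); first by rewrite modulusN.
rewrite leNgt; apply/negP => lt_Nw.
have := modulusD P.[w] P.[- w].
rewrite sumP -mulr_natr modulusM modulus_nat.
rewrite E0 in le_v.
lra.
Qed.

End Modulus.

(** * The maximum principle for quotients of polynomials *)

Section MaxQuot.
Variable R : realType.
Implicit Types (z w : R[i]) (x : R).

(** As [N] grows, [theta ^+ N] tends to 0 while the exponent [n] stays fixed, so the inequality
    passes to the limit. *)
Lemma le_of_le_mul_pert (a M theta : R) (n : nat) : 0 <= theta < 1 ->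
  (forall N, a <= M * (1 + theta ^+ N) ^+ n) -> a <= M.
Proof.
move=> /andP[th0 th1] le_a.
have th_cvg : (fun N => theta ^+ N) @ \oo --> (0 : R).
  by apply: cvg_expr; rewrite ger0_norm.
have cv : (fun N => M * (1 + theta ^+ N) ^+ n) @ \oo --> M * (1 + 0) ^+ n.
  apply: cvgMr.
  have c1 : (fun N => 1 + theta ^+ N) @ \oo --> (1 + 0 : R).
    by apply: cvgD => //; exact: cvg_cst.
  exact: (cvg_comp _ _ c1 (@exprn_continuous R n (1 + 0))).
rewrite addr0 expr1n mulr1 in cv.
rewrite -(cvg_lim _ cv) //; apply: limr_ge; first by apply/cvg_ex; exists M.
exact: nearW.
Qed.

(* 1 / (1 - alpha * w) is a geometric series on the closed disc; truncating
   these series turns the quotient into polynomials, up to factors that tend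
   to 1. *)
Lemma max_modulus_quot0 (S : {poly R[i]}) (s : seq R[i]) (rho theta M : R) :
  0 <= rho -> theta < 1 ->
  {in s, forall alpha, modulus alpha * rho <= theta} ->
  (forall w, modulus w = rho ->
    modulus S.[w] <= M * \prod_(alpha <- s) modulus (1 - alpha * w)) ->
  modulus S.[0] <= M.
Proof.
move=> rho0 th1 s_le le_S.
have M0 : 0 <= M.
  have [w w_rho _] := max_modulus0 S rho0.
  have Pgt0 : 0 < \prod_(alpha <- s) modulus (1 - alpha * w).
    rewrite big_seq; apply: prodr_gt0 => alpha /s_le le_th.
    rewrite modulus_gt0 subr_eq0; apply/eqP => aw1.
    by have := modulus1 R; rewrite aw1 modulusM w_rho; lra.
  rewrite -(pmulr_lge0 _ Pgt0).
  by apply: le_trans (le_S w w_rho); exact: modulus_ge0.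
(* A negative [theta] forces [s] to be empty, and then [max_modulus0] suffices. *)
have [th0 | th_lt0] := lerP 0 theta; last first.
  have s0 : s = [::].
    case: s s_le {le_S} => // b s s_le; exfalso.
    by have := s_le b (mem_head _ _); have := mulr_ge0 (modulus_ge0 b) rho0;
      lra.
  have [w w_rho le_w] := max_modulus0 S rho0.
  by apply: le_trans le_w _; have := le_S w w_rho; rewrite s0 big_nil mulr1.
apply: (@le_of_le_mul_pert _ _ theta (size s)); first by rewrite th0.
move=> N; pose G alpha : {poly R[i]} := \sum_(i < N.+1) (alpha *: 'X) ^+ i.
have GE alpha w : (G alpha).[w] = \sum_(i < N.+1) (alpha * w) ^+ i.
  by rewrite horner_sum; apply: eq_bigr => i _; rewrite !hornerE.
pose P := S * \prod_(alpha <- s) G alpha.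
have PE w : P.[w] = S.[w] * \prod_(alpha <- s) \sum_(i < N.+1) (alpha * w) ^+ i.
  by rewrite hornerM horner_prod; congr (_ * _); apply: eq_bigr.
have P0 : P.[0] = S.[0].
  rewrite PE [X in _ * X]big1 ?mulr1 // => alpha _; rewrite mulr0.
  by rewrite big_ord_recl expr0 big1 ?addr0 // => i _; rewrite expr0n.
have [w w_rho] := max_modulus0 P rho0.
rewrite P0 => /le_trans; apply; rewrite PE modulusM.
apply: le_trans (ler_wpM2r (modulus_ge0 _) (le_S w w_rho)) _.
rewrite -mulrA ler_wpM2l // modulus_prod -big_split /=.
apply: (@le_trans _ _ (\prod_(alpha <- s) (1 + theta ^+ N))); last first.
  by rewrite big_const_seq count_predT iter_mulr_1.
rewrite big_seq [leRHS]big_seq; apply: ler_prod => alpha /s_le le_th.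
rewrite mulr_ge0 ?modulus_ge0 //= -modulusM.
(* Telescoping: [1 - x] times the truncated series is [1 - x ^+ N.+1], here with [|x| <= theta]. *)
rewrite -[1 - _]opprB mulNr modulusN -subrX1.
apply: le_trans (modulus_subD _ _) _; rewrite modulus1 addrC lerD2l.
apply: (@le_trans _ _ (theta ^+ N.+1)).
  by rewrite modulusX modulusM w_rho lerXn2r // nnegrE mulr_ge0 ?modulus_ge0.
by rewrite exprS ler_piMl ?exprn_ge0 // ltW.
Qed.

End MaxQuot.

(** * A mean value inequality, and a point near infinity where the derivative is large *)

Section LargeDerivative.
Variable R : realType.
Implicit Types (z w : R[i]) (p : {poly R[i]}).

Lemma ReD z w : complex.Re (z + w) = complex.Re z + complex.Re w.
Proof. by case: z w => a b []. Qed.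

(** On the real axis this is the real part of [p], which makes the real mean value theorem
    applicable. *)
Definition Re_poly p : {poly R} := \poly_(i < size p) complex.Re p`_i.

Lemma coef_Re_poly p i : (Re_poly p)`_i = complex.Re p`_i.
Proof. by rewrite coef_poly; case: ltnP => // /(nth_default 0) ->. Qed.

Lemma horner_Re_poly p (t : R) : (Re_poly p).[t] = complex.Re p.[t%:C].
Proof.
have Re0 : complex.Re (0 : R[i]) = 0 by [].
rewrite horner_poly horner_coef (big_morph _ ReD Re0).
apply: eq_bigr => i _; rewrite -rmorphXn.
by case: p`_i => a b /=; rewrite mulr0 subr0.
Qed.

Lemma deriv_Re_poly p : (Re_poly p)^`() = Re_poly p^`().
Proof.
apply/polyP => i; rewrite coef_deriv !coef_Re_poly coef_deriv.
by elim: {2 4}i.+1 => // n IHn; rewrite !mulrS ReD -IHn.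
Qed.

Lemma poly_mean_value p (z0 z1 : R[i]) :
  exists2 t : R, 0 <= t <= 1 &
    modulus (p.[z1] - p.[z0])
    <= modulus p^`().[z0 + t%:C * (z1 - z0)] * modulus (z1 - z0).
Proof.
set D := p.[z1] - p.[z0]; have [-> | D0] := eqVneq D 0.
  by exists 0; rewrite ?lexx ?ler01 // modulus0 mulr_ge0 ?modulus_ge0.
(* With the factor [D^*], the increment of [P] from 0 to 1 is the real number [|D|^2], so taking
   real parts loses nothing. *)
pose P := D^*%C *: (p \Po (z0%:P + (z1 - z0) *: 'X)).
have PE w : P.[w] = D^*%C * p.[z0 + w * (z1 - z0)].
  by rewrite /P hornerZ horner_comp !hornerE [w * _]mulrC.
have dPE w : P^`().[w] = D^*%C * (p^`().[z0 + w * (z1 - z0)] * (z1 - z0)).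
  rewrite /P derivZ hornerZ deriv_comp hornerM horner_comp derivD derivC derivZ
    derivX.
  by rewrite add0r alg_polyC hornerC !(hornerD, hornerZ, hornerX,
    hornerC) [w * _]mulrC mulrA.
have [t] := poly_mvt (Re_poly P) (@ltr01 R).
rewrite in_itv /= => /andP[t0 t1].
rewrite deriv_Re_poly !horner_Re_poly dPE !PE rmorph0 rmorph1 subr0 mulr1 mul0r
  mul1r addr0.
rewrite [z0 + (z1 - z0)]addrC subrK => mvt.
exists t; first by rewrite !ltW.
have D_gt0 : 0 < modulus D by rewrite modulus_gt0.
suff : modulus D * modulus D
    <= modulus (D^*%C * (p^`().[z0 + t%:C * (z1 - z0)] * (z1 - z0))).
  by rewrite !modulusM modulus_conj ler_pM2l.
have -> : modulus D * modulus D
    = complex.Re (D^*%C * p.[z1]) - complex.Re (D^*%C * p.[z0]).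
  transitivity (complex.Re (D^*%C * D)).
    by rewrite [D^*%C * D]mulrC mulr_conj /= expr2.
  by rewrite /D mulrBr; case: (_ * _) => a b; case: (_ * _) => c d.
rewrite mvt; exact: le_trans (ler_norm _) (Re_le_modulus _).
Qed.

(** From [z1 / 4] to [z1] the factors of [A] gain at least [2 ^+ size A], while those of [B] lose at
    most [(rho / 4 + 1) ^+ size B]; the size hypothesis leaves a net gain of 2. *)
Lemma exists_large_deriv (A B : seq R[i]) (rho : R) :
  {in A, forall a, modulus a <= 1} -> {in B, forall b, 1 <= modulus b} ->
  16 <= rho -> 2 * (rho / 4 + 1) ^+ size B <= 2 ^+ size A ->
  exists2 z, rho / 4 <= modulus z <= rho &
    (\prod_(a <- A) modulus (z - a)) * \prod_(b <- B) modulus b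
    <= 2 * rho *
       modulus (\prod_(a <- A) ('X - a%:P)
                * \prod_(b <- B) ('X - b%:P))^`().[z].
Proof.
move=> A1 B1 rho16 le_size.
set pA := \prod_(a <- A) _; set pB := \prod_(b <- B) ('X - b%:P).
have hA z : modulus pA.[z] = \prod_(a <- A) modulus (z - a).
  by rewrite horner_prod modulus_prod; apply: eq_bigr => a _; rewrite !hornerE.
have hB z : modulus pB.[z] = \prod_(a <- B) modulus (z - a).
  by rewrite horner_prod modulus_prod; apply: eq_bigr => a _; rewrite !hornerE.
have rho_ge0 : 0 <= rho by lra.
have [z1 z1_rho] := max_modulus0 pB rho_ge0.
have -> : modulus pB.[0] = \prod_(b <- B) modulus b.
  by rewrite hB; apply: eq_bigr => b _; rewrite sub0r modulusN.
move=> le_B; pose z0 := (4^-1)%:C * z1.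
have z0_rho : modulus z0 = rho / 4.
  by rewrite modulusM modulus_real z1_rho ger0_norm ?invr_ge0 // mulrC.
have [t t01] := poly_mean_value (pA * pB) z0 z1.
set s := 4^-1 + t * (1 - 4^-1); have s_bnd : 4^-1 <= s <= 1 by rewrite /s; lra.
have -> : z0 + t%:C * (z1 - z0) = s%:C * z1.
  by rewrite /z0 /s rmorphD rmorphM rmorphB rmorph1; ring.
have -> : modulus (z1 - z0) = rho * (3 / 4).
  have -> : z1 - z0 = (3 / 4)%:C * z1.
    have -> : (3 / 4 : R) = 1 - 4^-1 by field.
    by rewrite rmorphB rmorph1 /z0; ring.
  by rewrite modulusM modulus_real z1_rho ger0_norm ?divr_ge0 // mulrC.
set z := s%:C * z1.
have z_rho : modulus z = s * rho.
  by rewrite modulusM modulus_real z1_rho ger0_norm //; lra.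
move=> mv; exists z; first by rewrite z_rho; nra.
have z1a a : a \in A -> rho - 1 <= modulus (z1 - a).
  by move=> /A1 a1; apply: le_trans (modulus_ge_sub _ _); rewrite z1_rho; lra.
(* Since [rho >= 16], [|z1 - a| >= rho - 1 >= 2 * (rho / 4 + 1) >= 2 * |z0 - a|]. *)
have grow : 2 ^+ size A * modulus pA.[z0] <= modulus pA.[z1].
  rewrite !hA -(iter_mulr_1 (size A)) -(count_predT A) -big_const_seq
    -big_split /=.
  rewrite big_seq [leRHS]big_seq; apply: ler_prod => a aA.
  rewrite mulr_ge0 ?modulus_ge0 //=; apply: le_trans (z1a a aA).
  have := modulus_subD z0 a; have := A1 a aA; rewrite z0_rho; lra.
(* [z - a] is a convex combination of [z1 - a] and [- a], and [|a| <= 1 <= |z1 - a|]. *)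
have mono : modulus pA.[z] <= modulus pA.[z1].
  rewrite !hA big_seq [leRHS]big_seq; apply: ler_prod => a aA.
  rewrite modulus_ge0 /=.
  have -> : z - a = s%:C * (z1 - a) + (1 - s)%:C * - a.
    by rewrite /z rmorphB rmorph1; ring.
  apply: le_trans (modulusD _ _) _; rewrite !modulusM !modulus_real modulusN.
  rewrite !ger0_norm; [|lra|lra].
  have := z1a a aA; have := A1 a aA; nra.
set K := (rho / 4 + 1) ^+ size B.
have K_gt0 : 0 < K by rewrite exprn_gt0 //; lra.
have le_B0 : modulus pB.[z0] <= K * modulus pB.[z1].
  apply: (@le_trans _ _ (K * \prod_(b <- B) modulus b)); last first.
    by rewrite ler_wpM2l // ltW.
  rewrite hB /K -(iter_mulr_1 (size B)) -(count_predT B) -big_const_seq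
    -big_split /=.
  rewrite big_seq [leRHS]big_seq; apply: ler_prod => b bB.
  rewrite modulus_ge0 /=; apply: le_trans (modulus_subD _ _) _; rewrite z0_rho.
  have := B1 b bB; nra.
have half : 2 * modulus (pA * pB).[z0] <= modulus (pA * pB).[z1].
  rewrite -(ler_pM2l K_gt0) !hornerM !modulusM.
  apply: (@le_trans _ _ (modulus pA.[z1] * modulus pB.[z0])).
    rewrite mulrA mulrA ler_wpM2r ?modulus_ge0 //; apply: le_trans grow.
    by rewrite mulrA ler_wpM2r ?modulus_ge0 // mulrC.
  by rewrite mulrCA ler_wpM2l ?modulus_ge0.
have := modulus_ge_sub (pA * pB).[z1] (pA * pB).[z0].
have le_p1 : modulus pA.[z] * \prod_(b <- B) modulus b <=
  modulus (pA * pB).[z1].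
  rewrite hornerM modulusM; apply: ler_pM => //; first exact: modulus_ge0.
  by apply: prodr_ge0 => b _; exact: modulus_ge0.
have := modulus_ge0 (pA * pB)^`().[z].
rewrite -hA; move: mv half le_p1.
set x := modulus _^`().[z]; nra.
Qed.
End LargeDerivative.

(** * The Jensen-type bound on the number of far critical points *)

Section FarZeros.
Variable R : realType.
Implicit Types (z w v a b : R[i]) (A B Z s : seq R[i]).

Lemma prodr_const_seq s (x : R) : \prod_(a <- s) x = x ^+ size s.
Proof. by rewrite big_const_seq count_predT iter_mulr_1. Qed.

(** Each term of the product rule lacks one factor, whose bound [U a] is at least [T]; so [T] times
    a term is at most the full product of the bounds. *)
Lemma deriv_prod_bound s z (U : R[i] -> R) (T : R) : 0 < T ->
  {in s, forall a, modulus (z - a) <= U a} -> {in s, forall a, T <= U a} ->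
  modulus (\prod_(a <- s) ('X - a%:P))^`().[z] * T
    <= (size s)%:R * \prod_(a <- s) U a.
Proof.
move=> T0; elim: s => [|a s IHs] le_U T_U.
  by rewrite !big_nil derivC hornerC modulus0 !mul0r.
have U0 : {in s, forall a, 0 <= U a}.
  by move=> b bs; apply: le_trans (ltW T0) (T_U b _); rewrite inE bs orbT.
have {}IHs : modulus (\prod_(a <- s) ('X - a%:P))^`().[z] * T
    <= (size s)%:R * \prod_(a <- s) U a.
  by apply: IHs => b bs; [apply: le_U | apply: T_U]; rewrite inE bs orbT.
have aU := le_U a (mem_head _ _); have Ta := T_U a (mem_head _ _).
have ps : modulus (\prod_(b <- s) ('X - b%:P)).[z] <= \prod_(b <- s) U b.
  rewrite horner_prod modulus_prod big_seq [leRHS]big_seq.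
  apply: ler_prod => b bs.
  by rewrite modulus_ge0 !hornerE le_U // inE bs orbT.
rewrite !big_cons derivM derivXsubC mul1r hornerD.
apply: le_trans (ler_wpM2r (ltW T0) (modulusD _ _)) _.
rewrite mulrDl -[size (a :: s)]/(size s).+1 -natr1.
rewrite [leRHS]mulrDl mul1r [leRHS]addrC; apply: lerD.
  by rewrite mulrC; apply: ler_pM => //; [exact: ltW | exact: modulus_ge0].
rewrite hornerM modulusM -mulrA [leRHS]mulrCA; apply: ler_pM => //.
- exact: modulus_ge0.
- by rewrite mulr_ge0 ?modulus_ge0 // ltW.
- by rewrite !hornerE.
Qed.

Lemma prod_modulus_inv s w : w != 0 ->
  \prod_(a <- s) modulus (1 - a * w)
    = modulus w ^+ size s * \prod_(a <- s) modulus (w^-1 - a).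
Proof.
move=> w0; rewrite -prodr_const_seq -big_split; apply: eq_bigr => a _ /=.
by rewrite -modulusM mulrBr divff // [w * a]mulrC.
Qed.

(* [rho - e^* v / rho] is [v - e] divided by its Blaschke factor: on the circle
   the modulus is the same, but at [v = 0] it is [rho] instead of [|e|]. *)
Lemma modulus_reflect (rho : R) (e v : R[i]) : 0 < rho -> modulus v = rho ->
  modulus (rho%:C - e^*%C / rho%:C * v) = modulus (v - e).
Proof.
move=> rho0 v_rho; have rhoC : rho%:C != 0 by rewrite fmorph_eq0 gt_eqF.
have -> : rho%:C - e^*%C / rho%:C * v = v / rho%:C * (v - e)^*%C.
  have vv : v * v^*%C = rho%:C * rho%:C.
    by rewrite mulr_conj v_rho expr2 rmorphM.
  transitivity ((v * v^*%C - v * e^*%C) / rho%:C); first by rewrite vv; field.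
  by rewrite rmorphB /=; field.
rewrite !modulusM modulus_conj modulusV modulus_real v_rho ger0_norm ?ltW //.
by rewrite divff ?mul1r // gt_eqF.
Qed.

(** Jensen's inequality is applied on the disc of radius [1 - 2 * tau] about a point [w0],
    [|w0| <= tau], where the derivative is large. The disc stays in [|w| <= 1 - tau], away from the
    inverses of the zeros in [A], while the inverse of a far zero is within [1 - 3 * tau] of
    [w0]. *)
Lemma far_zeros_bound A B Z (tau : R) :
  0 < tau < 4^-1 ->
  {in A, forall a, modulus a <= 1} -> {in B, forall b, 1 < modulus b} ->
  (size Z).+1 = (size A + size B)%N ->
  (\prod_(a <- A) ('X - a%:P) * \prod_(b <- B) ('X - b%:P))^`()
    = (size A + size B)%:R *: \prod_(z <- Z) ('X - z%:P) ->
  2 * (tau^-1 + 1) ^+ size B <= 2 ^+ size A ->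
  ((1 - 2 * tau) / (1 - 3 * tau))
      ^+ count (fun z => 1 <= (1 - 4 * tau) * modulus z) Z
    <= 8 * (size A + size B)%:R / tau ^+ 2 * (8 / tau) ^+ size B.
Proof.
move=> /andP[tau0 tau4] A1 B1 sizeZ deriv_p le_size.
set m := (size A + size B)%N in sizeZ deriv_p *.
have m_gt0 : 0 < m%:R :> R by rewrite ltr0n -sizeZ.
have hZ z :
    modulus (\prod_(a <- A) ('X - a%:P) * \prod_(b <- B) ('X - b%:P))^`().[z]
    = m%:R * \prod_(x <- Z) modulus (z - x).
  rewrite deriv_p hornerZ modulusM modulus_nat horner_prod modulus_prod.
  by congr (_ * _); apply: eq_bigr => x _; rewrite !hornerE.
have B1' : {in B, forall b, 1 <= modulus b} by move=> b /B1 /ltW.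
have rho16 : 16 <= 4 / tau by rewrite ler_pdivlMr //; lra.
have [|z2 z2_bnd] := exists_large_deriv A1 B1' rho16.
  by have -> : 4 / tau / 4 = tau^-1 by field; rewrite gt_eqF.
rewrite hZ => le_z2.
have z2_gt0 : 0 < modulus z2 by lra.
have z20 : z2 != 0 by rewrite -modulus_gt0.
set w0 := z2^-1.
have w00 : w0 != 0 by rewrite invr_eq0.
have [w0_ge w0_le] : tau / 4 <= modulus w0 /\ modulus w0 <= tau.
  have tau_inv : 4 / tau / 4 = tau^-1 by field; rewrite gt_eqF.
  move: z2_bnd; rewrite tau_inv modulusV => /andP[z2l z2u]; split.
    by rewrite -[tau / 4]invf_div lef_pV2 ?posrE // divr_gt0.
  by rewrite -[leRHS]invrK lef_pV2 ?posrE // invr_gt0.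
set rho := 1 - 2 * tau; have rho0 : 0 < rho by rewrite /rho; lra.
set lam := rho / (1 - 3 * tau).
have lam1 : 1 <= lam by rewrite ler_pdivlMr /rho; lra.
set far := (fun z => 1 <= (1 - 4 * tau) * modulus z).
(* In the variable [v = w - w0], a far [z] contributes the zero [z^-1 - w0] inside the circle, and
   its factor is reflected; the other factors stay [1 - z * (w0 + v)]. *)
pose F z : {poly R[i]} := if far z
  then z *: (rho%:C%:P - ((z^-1 - w0)^*%C / rho%:C) *: 'X)
  else (1 - z * w0)%:P - z *: 'X.
have F_circle z v : modulus v = rho ->
    modulus (F z).[v] = modulus (1 - z * (w0 + v)).
  move=> v_rho; rewrite /F; case: ifPn => [z_far|_]; last first.
    by rewrite !hornerE mulrDr opprD addrA.
  have z0 : z != 0.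
    by apply: contraTneq z_far => ->; rewrite /far modulus0 mulr0 -ltNge ltr01.
  rewrite !hornerE modulusM modulus_reflect // -modulusM -modulusN.
  by congr modulus; field.
have F0 z : (if far z then lam else 1) * modulus (1 - z * w0) <=
  modulus (F z).[0].
  rewrite /F; case: (boolP (far z)) => [z_far|_]; last first.
    by rewrite !hornerE subr0.
  have z_gt0 : 0 < modulus z.
    by move: z_far; rewrite /far; have := modulus_ge0 z; nra.
  have z0 : z != 0 by rewrite -modulus_gt0.
  have -> : 1 - z * w0 = z * (z^-1 - w0) by field.
  rewrite !hornerE subr0 !modulusM modulus_real ger0_norm ?(ltW rho0) // mulrCA.
  rewrite ler_wpM2l ?modulus_ge0 //.
  rewrite /lam mulrAC ler_pdivrMr; last by lra.
  rewrite ler_wpM2l ?(ltW rho0) //.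
  apply: le_trans (modulus_subD _ _) _.
  have : modulus z^-1 <= 1 - 4 * tau.
    by rewrite modulusV -(ler_pM2r z_gt0) mulVf ?gt_eqF.
  lra.
(* At [v = w - w0] with [|v| = rho], [S] has the modulus of [prod (1 - z w)],
   that is, of [w^(m-1) p'(1/w) / m]; at [v = 0] each far zero makes it larger
   by a factor at least [lam]. *)
pose S := \prod_(z <- Z) F z.
have S0 : lam ^+ count far Z * \prod_(z <- Z) modulus (1 - z * w0) <=
  modulus S.[0].
  rewrite horner_prod modulus_prod.
  have -> : lam ^+ count far Z = \prod_(z <- Z) (if far z then lam else 1).
    by rewrite -big_mkcond big_const_seq iter_mulr_1.
  rewrite -big_split /=; apply: ler_prod => z _; rewrite F0 andbT.
  by rewrite mulr_ge0 ?modulus_ge0 //; case: ifP => // _; exact: le_trans lam1.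
pose X := \prod_(a <- A) modulus (1 - a * w0).
have aw0 a : a \in A -> 1 - tau <= modulus (1 - a * w0).
  move=> /A1 a1; apply: le_trans (modulus_ge_sub _ _).
  rewrite modulus1 modulusM; have := modulus_ge0 a; have := modulus_ge0 w0; nra.
have aw0_neq0 a : a \in A -> 1 - a * w0 != 0.
  by move=> /aw0; rewrite -modulus_gt0; lra.
pose M := tau^-1 * X * \prod_(b <- B) (2 * modulus b).
(* The factors of [A] fit [max_modulus_quot0] because [1 - a * (w0 + v) = (1 - a * w0) * (1 - alpha
   * v)] with [alpha = a / (1 - a * w0)]. *)
have S0_le : modulus S.[0] <= M.
  apply: (@max_modulus_quot0 _ S [seq a / (1 - a * w0) | a <- A] 
    rho (rho / (1 - tau))).
  - exact: ltW.
  - by rewrite ltr_pdivrMr /rho; lra.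
  - move=> _ /mapP[a aA ->]; rewrite mulrC ler_wpM2l ?(ltW rho0) //.
    rewrite modulusM modulusV ler_pdivrMr ?modulus_gt0 ?aw0_neq0 //.
    apply: le_trans (A1 a aA) _; rewrite mulrC ler_pdivlMr ?mul1r ?aw0 //; lra.
  move=> v v_rho; set w := w0 + v.
  have -> : modulus S.[v] = \prod_(z <- Z) modulus (1 - z * w).
    by rewrite horner_prod modulus_prod; apply: eq_bigr => z _;
      rewrite F_circle.
  have -> : M * \prod_(alpha <- [seq a / (1 - a * w0) | a <- A])
                  modulus (1 - alpha * v)
      = tau^-1 * (\prod_(a <- A) modulus (1 - a * w))
        * \prod_(b <- B) (2 * modulus b).
    rewrite /M mulrAC; congr (_ * _); rewrite -mulrA; congr (_ * _).
    rewrite big_map -big_split /= big_seq [RHS]big_seq; apply: eq_bigr => a aA.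
    by rewrite -modulusM; congr modulus; rewrite /w; field; exact: aw0_neq0.
  have w_le : modulus w <= 1 - tau.
    have := modulusD w0 v; rewrite v_rho /rho -/w; lra.
  have w_gt0 : 0 < modulus w.
    have := modulus_ge_sub v (- w0).
    rewrite opprK [v + w0]addrC -/w v_rho modulusN /rho; lra.
  have wn0 : w != 0 by rewrite -modulus_gt0.
  set z := w^-1; have z_w : modulus z = (modulus w)^-1 by rewrite modulusV.
  have z_gt0 : 0 < modulus z by rewrite z_w invr_gt0.
  have z_tau : modulus z * tau <= modulus z - 1.
    have : 1 <= modulus z * (1 - tau) by rewrite z_w mulrC ler_pdivlMr // mul1r.
    lra.
  (* For [b] in [B], [|z - b| <= |z| + |b| <= 2 * |b| * |z|] as both moduli exceed 1. For [a] in
     [A], [|z - a| >= |z| - 1 >= |z| * tau]. *)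
  have := @deriv_prod_bound (A ++ B) z
    (fun a => if modulus a <= 1 then modulus (z - a)
              else 2 * modulus a * modulus z)
    (modulus z * tau).
  rewrite !big_cat /= hZ size_cat -/m => bound.
  have {bound} bound : (\prod_(x <- Z) modulus (z - x)) * (modulus z * tau)
      <= (\prod_(a <- A) modulus (z - a))
         * ((\prod_(b <- B) (2 * modulus b)) * modulus z ^+ size B).
    rewrite -(ler_pM2l m_gt0) [leLHS]mulrA; apply: le_trans (bound _ _ _) _.
    - by rewrite mulr_gt0.
    - move=> a; rewrite mem_cat; case: ifPn => // /negP a1 /orP[/A1 //|/B1 b1].
      apply: le_trans (modulus_subD _ _) _; nra.
    - move=> a _; case: ifPn => [a1|].
        by apply: le_trans (modulus_ge_sub _ _); lra.
      rewrite -ltNge => a1; nra.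
    rewrite ler_wpM2l ?(ltW m_gt0) // -prodr_const_seq -big_split /=.
    rewrite le_eqVlt; apply/orP; left; apply/eqP; congr (_ * _).
      by rewrite big_seq [RHS]big_seq; apply: eq_bigr => a /A1 ->.
    by rewrite big_seq [RHS]big_seq; apply: eq_bigr => b /B1;
      rewrite ltNge => /negbTE ->.
  rewrite !prod_modulus_inv // -/z.
  move: bound.
  set PZ := \prod_(x <- Z) _; set PA := \prod_(a <- A) _.
  set PB := \prod_(b <- B) _.
  have wz : modulus w * modulus z = 1 by rewrite z_w divff // gt_eqF.
  have wk : modulus w ^+ size B * modulus z ^+ size B = 1.
    by rewrite -exprMn wz expr1n.
  move=> bound; rewrite -mulrA -(ler_pM2l tau0) [leRHS]mulrA divff ?gt_eqF //
    mul1r.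
  (* Multiplying by [|w| ^+ m] returns to the variable [w]; as [Z] has [m - 1] elements, one factor
     [|w|] remains to cancel [|z|]. *)
  have := ler_wpM2l (exprn_ge0 m (ltW w_gt0)) bound.
  have -> : modulus w ^+ m * (PZ * (modulus z * tau)) =
    tau * (modulus w ^+ size Z * PZ).
    rewrite -sizeZ exprS.
    transitivity ((modulus w * modulus z) * (tau * (modulus w ^+ size Z * PZ))).
      by ring.
    by rewrite wz mul1r.
  have -> : modulus w ^+ m * (PA * (PB * modulus z ^+ size B)) =
    modulus w ^+ size A * PA * PB.
    rewrite exprD.
    transitivity ((modulus w ^+ size B * modulus z ^+ size B)
      * (modulus w ^+ size A * PA * PB)); first by ring.
    by rewrite wk mul1r.
  by [].
have X_gt0 : 0 < X.
  by rewrite /X big_seq; apply: prodr_gt0 => a aA; rewrite modulus_gt0 aw0_neq0.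
set PB := \prod_(b <- B) modulus b in le_z2.
have PB_gt0 : 0 < PB by rewrite /PB big_seq; apply: prodr_gt0 => b /B1; lra.
have w0_gt0 : 0 < modulus w0 by rewrite modulus_gt0.
have := le_trans S0 S0_le; rewrite /M big_split /= prodr_const_seq -/PB.
set L := lam ^+ _; set PZ := \prod_(z <- Z) modulus (1 - z * w0) => le_L.
have L0 : 0 <= L by rewrite exprn_ge0 //; lra.
have PZ0 : 0 <= PZ by apply: prodr_ge0 => z _; exact: modulus_ge0.
(* This is the lower bound at [z2] times [|w0| ^+ m], with a spare factor [|w0| <= 1] dropped. *)
have {}le_z2 : modulus w0 ^+ size B * (X * PB) <= 8 / tau * m%:R * PZ.
  have := ler_wpM2l (exprn_ge0 m (ltW w0_gt0)) le_z2.
  rewrite /X /PZ !prod_modulus_inv // invrK.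
  set PA := \prod_(a <- A) _; set PZ' := \prod_(z <- Z) _.
  have -> : modulus w0 ^+ m * (PA * PB) =
    modulus w0 ^+ size B * (modulus w0 ^+ size A * PA * PB).
    by rewrite exprD; ring.
  move=> /le_trans; apply; rewrite -sizeZ exprS.
  have -> : modulus w0 * modulus w0 ^+ size Z
        * (2 * (4 / tau) * ((size Z).+1%:R * PZ'))
      = modulus w0 * (8 / tau * (size Z).+1%:R * (modulus w0 ^+ size Z * PZ')).
    by field; rewrite gt_eqF.
  rewrite ler_piMl //; last by lra.
  have PZ'0 : 0 <= PZ' by apply: prodr_ge0 => x _; exact: modulus_ge0.
  by rewrite !mulr_ge0 ?invr_ge0 ?exprn_ge0 ?modulus_ge0 ?(ltW tau0).
(* [X * PB] occurs in both the lower and the upper bound, and cancels. *)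
have L_w0 : L * modulus w0 ^+ size B <= 8 * m%:R / tau ^+ 2 * 2 ^+ size B.
  rewrite -(ler_pM2r (mulr_gt0 X_gt0 PB_gt0)) -[leLHS]mulrA.
  apply: le_trans (ler_wpM2l L0 le_z2) _.
  have c0 : 0 <= 8 / tau * m%:R by rewrite !mulr_ge0 ?invr_ge0 ?(ltW tau0)
    ?(ltW m_gt0).
  have := ler_wpM2l c0 le_L.
  have -> : 8 / tau * m%:R * (L * PZ) = L * (8 / tau * m%:R * PZ) by ring.
  move=> /le_trans; apply; rewrite le_eqVlt; apply/orP; left; apply/eqP.
  by field; rewrite gt_eqF.
(* [|w0| >= tau / 4] replaces [|w0| ^+ size B], and [2 / (tau / 4) = 8 / tau]. *)
have tk : 0 < (tau / 4) ^+ size B by rewrite exprn_gt0 ?divr_gt0.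
rewrite -(ler_pM2r tk) -[leRHS]mulrA -exprMn.
have -> : 8 / tau * (tau / 4) = 2 by field; rewrite gt_eqF.
apply: le_trans L_w0; rewrite ler_wpM2l // lerXn2r // nnegrE; first by lra.
exact: modulus_ge0.
Qed.

End FarZeros.

(** * Lists of roots, and the asymptotic count of critical points far from one disc *)

Section Roots.
Variable R : realType.
Implicit Types (z w v a b : R[i]) (A B Z s : seq R[i]).

(** Passes from the finitely supported sum to lists of roots with repetition. *)
Lemma nzeros_prod_XsubC (D : set R[i]^o) (p : {poly R[i]}) (c : R[i]) s :
  c != 0 -> p = c *: \prod_(a <- s) ('X - a%:P) ->
  nzeros D p = count (fun a => `[< D a >]) s.
Proof.
move=> c0 ->.
have mupE z : mup z (c *: \prod_(a <- s) ('X - a%:P)) = count_mem z s.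
  by rewrite -mul_polyC mupMr ?mu_prod_XsubC // rootE hornerC.
rewrite /nzeros (fsbigE [seq a <- undup s | `[< D a >]]).
- rewrite big_filter_cond -sum1_count -[RHS]big_undup_iterop_count.
  apply: eq_big => [a|a _].
    by apply/andP/asboolP => [[/asboolP]//|Da]; split;
      [exact/asboolP | exact/mem_set].
  by rewrite mupE Monoid.iteropE iter_addn_0 mul1n.
- by rewrite filter_uniq ?undup_uniq.
- by move=> a; rewrite /= mem_filter => /andP[/asboolP].
- move=> a Da; rewrite mem_filter mem_undup negb_and (asboolT Da) /=.
  by rewrite mupE => /count_memPn.
Qed.

(** In characteristic 0 the leading coefficient [size s] of the derivative is nonzero, so the degree
    drops by exactly one. *)
Lemma deriv_roots s : (0 < size s)%N -> exists2 Z,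
  (\prod_(a <- s) ('X - a%:P))^`() = (size s)%:R *: \prod_(z <- Z) ('X - z%:P)
  & (size Z).+1 = size s.
Proof.
move=> s0; set q := \prod_(a <- s) _.
have size_q : size q = (size s).+1 by rewrite size_prod_XsubC.
have lead : (q^`())`_(size s).-1 = (size s)%:R.
  rewrite coef_deriv prednK //; have /monicP := monic_prod_XsubC s xpredT id.
  by rewrite -/q /lead_coef size_q /= => ->.
have sn0 : (size s)%:R != 0 :> R[i] by rewrite pnatr_eq0 -lt0n.
have size_q' : size q^`() = size s.
  apply/eqP; rewrite eqn_leq; apply/andP; split.
    by rewrite -ltnS -size_q lt_size_deriv // -size_poly_gt0 size_q.
  rewrite leqNgt; apply/negP => lt_s; move: lead.
  rewrite nth_default; last by rewrite -ltnS prednK.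
  by move/esym/eqP; rewrite (negbTE sn0).
have [Z DZ] := closed_field_poly_normal q^`().
have lead_q' : lead_coef q^`() = (size s)%:R by rewrite /lead_coef size_q'.
exists Z; first by rewrite DZ lead_q'.
by rewrite -size_q' DZ size_scale ?lead_q' // size_prod_XsubC.
Qed.

Lemma prod_XsubC_affine s (c : R[i]) (r : R[i]) : r != 0 ->
  (\prod_(a <- s) ('X - a%:P)) \Po (c%:P + r *: 'X)
   = r ^+ size s *: \prod_(a <- [seq (a - c) / r | a <- s]) ('X - a%:P).
Proof.
move=> r0; elim: s => [|a s IHs]; first by rewrite !big_nil comp_polyC scale1r.
rewrite /= !big_cons comp_polyM IHs comp_polyB comp_polyX comp_polyC.
have -> : c%:P + r *: 'X - a%:P = r *: ('X - ((a - c) / r)%:P).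
  by rewrite scalerBr scale_polyC mulrC divfK // polyCB; ring.
by rewrite -scalerAl -scalerAr scalerA exprS.
Qed.

(** The factor [r] from the chain rule makes up for [Z] having one element fewer than [s]. *)
Lemma deriv_prod_XsubC_affine s Z (c r : R[i]) : r != 0 ->
  (size Z).+1 = size s ->
  (\prod_(a <- s) ('X - a%:P))^`() = (size s)%:R *:
    \prod_(z <- Z) ('X - z%:P) ->
  (\prod_(a <- [seq (a - c) / r | a <- s]) ('X - a%:P))^`()
    = (size s)%:R *: \prod_(z <- [seq (z - c) / r | z <- Z]) ('X - z%:P).
Proof.
move=> r0 sizeZ deriv_s.
have rs : r ^+ size s != 0 by rewrite expf_neq0.
apply: (scalerI rs); rewrite -derivZ -prod_XsubC_affine // deriv_comp deriv_s.
rewrite comp_polyZ prod_XsubC_affine // derivD derivC derivZ derivX add0r.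
by rewrite -sizeZ exprSr alg_polyC mulrC mul_polyC !scalerA; congr (_ *: _);
  ring.
Qed.

Lemma ln_le_linear (c d : R) : 0 < d ->
  exists M : nat, forall m : nat, (M <= m)%N -> c + ln m%:R <= d * m%:R.
Proof.
move=> d0; set h := d / 2; have h0 : 0 < h by rewrite divr_gt0.
exists (Num.truncn `|(c - ln h) / h|).+1 => m le_m.
have m0 : 0 < m%:R :> R by rewrite ltr0n; apply: leq_trans le_m.
have hm0 : 0 < h * m%:R by rewrite mulr_gt0.
have := ln_sublinear hm0; rewrite lnM ?posrE //.
have : (c - ln h) / h <= m%:R.
  apply: le_trans (ler_norm _) _; apply: le_trans (ltW (truncnS_gt _)) _.
  by rewrite ler_nat.
rewrite ler_pdivrMr // => le_c.
have -> : d = h + h by rewrite /h; field.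
lra.
Qed.

(** Logarithm of [far_zeros_bound]: the count times [ln lam] is at most a constant plus [ln m] plus
    [size B] times [ln (8 / tau)], where [m] is the degree. *)
Lemma few_far_zeros (tau eta : R) : 0 < tau < 4^-1 -> 0 < eta ->
  exists2 kappa : R, 0 < kappa & exists M : nat, forall A B Z,
    {in A, forall a, modulus a <= 1} -> {in B, forall b, 1 < modulus b} ->
    (size Z).+1 = (size A + size B)%N ->
    (\prod_(a <- A) ('X - a%:P) * \prod_(b <- B) ('X - b%:P))^`()
      = (size A + size B)%:R *: \prod_(z <- Z) ('X - z%:P) ->
    (M <= size A + size B)%N ->
    (size B)%:R <= kappa * (size A + size B)%:R ->
    (count (fun z => (1 <= (1 - 4 * tau) * modulus z)%R) Z)%:R
      <= eta * (size A + size B)%:R.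
Proof.
move=> tau_bnd eta0; have /andP[tau0 tau4] := tau_bnd.
set lam := (1 - 2 * tau) / (1 - 3 * tau).
have lam1 : 1 < lam by rewrite ltr_pdivlMr; lra.
have L0 : 0 < ln lam by rewrite ln_gt0.
have l20 : 0 < ln (2 : R) by rewrite ln_gt0 // ltr1n.
have K1 : 1 < 8 / tau by rewrite ltr_pdivlMr //; lra.
have K0 : 0 < ln (8 / tau) by rewrite ln_gt0.
set K := ln (8 / tau) in K0; set L := ln lam in L0; set l2 := ln 2 in l20.
(* The first bound secures the size hypothesis of [far_zeros_bound]; the second keeps [size B * K]
   below half of [eta * L * m], the other half being left to [ln_le_linear]. *)
pose kappa := Num.min (l2 / 2 / (K + l2)) (eta * L / 2 / K).
have kappa_l2 : kappa * (K + l2) <= l2 / 2.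
  by rewrite -ler_pdivlMr ?addr_gt0 // ge_min lexx.
have kappa_K : kappa * K <= eta * L / 2.
  by rewrite -ler_pdivlMr // ge_min lexx orbT.
exists kappa.
  by rewrite lt_min !divr_gt0 ?addr_gt0 ?mulr_gt0.
have [M ln_M] := ln_le_linear (ln (8 / tau ^+ 2)) (divr_gt0 (mulr_gt0 eta0 L0)
  (ltr0Sn R 1)).
exists (maxn M 2) => A B Z A1 B1 sizeZ deriv_AB; set m := (size A + size B)%N.
rewrite geq_max => /andP[le_M m2] le_B.
have m2' : 2 <= m%:R :> R by rewrite ler_nat.
have m_gt0 : 0 < m%:R :> R by lra.
have sA : (size A)%:R = m%:R - (size B)%:R :> R by rewrite /m natrD addrK.
have tau'0 : 0 < tau^-1 + 1 by rewrite addr_gt0 ?invr_gt0.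
(* In logarithms, [m >= 2] lets half of [m * ln 2] absorb the leading factor 2, and the bound on
   [size B] uses the other half. *)
have le_size : 2 * (tau^-1 + 1) ^+ size B <= 2 ^+ size A.
  rewrite -ler_ln ?posrE ?mulr_gt0 ?exprn_gt0 // lnM ?posrE ?exprn_gt0 //.
  rewrite (lnXn (size B) tau'0) (lnXn (size A) (ltr0Sn R 1)) -/l2.
  rewrite -[_ *+ size B]mulr_natr -[_ *+ size A]mulr_natr sA.
  have : ln (tau^-1 + 1) <= K.
    rewrite ler_ln ?posrE //; last by lra.
    rewrite -(ler_pM2r tau0) mulrDl mulVf ?gt_eqF // mulfVK ?gt_eqF //; lra.
  have := ler0n R (size B); nra.
have := far_zeros_bound tau_bnd A1 B1 sizeZ deriv_AB le_size.
rewrite -/lam -/m; set J := count _ _ => le_J.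
have t2 : 0 < 8 / tau ^+ 2 by rewrite divr_gt0 // exprn_gt0.
have lam0 : 0 < lam by lra.
have K'0 : 0 < 8 / tau by lra.
have : J%:R * L <= ln (8 / tau ^+ 2) + ln m%:R + (size B)%:R * K.
  rewrite /L /K [J%:R * _]mulrC [_ * ln (8 / tau)]mulrC !mulr_natr.
  rewrite -(lnXn J lam0) -(lnXn (size B) K'0) -lnM ?posrE // -lnM ?posrE;
    first last.
  - by rewrite exprn_gt0.
  - by rewrite mulr_gt0.
  rewrite ler_ln ?posrE ?exprn_gt0 //; first by rewrite [8 / _ * _]mulrAC.
  exact: mulr_gt0 (mulr_gt0 t2 m_gt0) (exprn_gt0 _ K'0).
have := ln_M m le_M => le_m le_JL.
rewrite -(ler_pM2r L0).
have := ler_wpM2r (ltW K0) le_B; nra.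
Qed.

Lemma few_zeros_far_from_disc (c : R[i]) (r r' eta : R) :
  0 < r < r' -> 0 < eta ->
  exists2 kappa : R, 0 < kappa & exists M : nat, forall s Z,
    (size Z).+1 = size s ->
    (\prod_(a <- s) ('X - a%:P))^`() = (size s)%:R *:
      \prod_(z <- Z) ('X - z%:P) ->
    (M <= size s)%N ->
    (count (fun a => (r < modulus (a - c))%R) s)%:R <= kappa * (size s)%:R ->
    (count (fun z => (r' <= modulus (z - c))%R) Z)%:R <= eta * (size s)%:R.
Proof.
move=> /andP[r0 rr'] eta0; have r'0 : 0 < r' by lra.
(* Chosen so that [1 - 4 * tau = r / r']: once the disc of radius [r] is rescaled to the unit disc,
   the far zeros are those beyond [r']. *)
pose tau := (1 - r / r') / 4.
have tau_r : 1 - 4 * tau = r / r' by rewrite /tau; field; rewrite gt_eqF.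
have rr'0 : 0 < r / r' by rewrite divr_gt0.
have rr'1 : r / r' < 1 by rewrite ltr_pdivrMr // mul1r.
have tau_bnd : 0 < tau < 4^-1 by lra.
have [kappa kappa0 [M HM]] := few_far_zeros tau_bnd eta0.
exists kappa => //; exists M => s Z sizeZ deriv_s le_M le_s.
have rC : r%:C != 0 by rewrite fmorph_eq0 gt_eqF.
have mod_r z : modulus ((z - c) / r%:C) = modulus (z - c) / r.
  by rewrite modulusM modulusV modulus_real gtr0_norm.
pose T := [seq (a - c) / r%:C | a <- s].
pose A := [seq a <- T | (modulus a <= 1)%R].
pose B := [seq a <- T | ~~ (modulus a <= 1)%R].
have sizeAB : (size A + size B)%N = size s.
  by rewrite !size_filter count_predC size_map.
have sizeB : size B = count (fun a => (r < modulus (a - c))%R) s.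
  rewrite size_filter count_map; apply: eq_count => a /=.
  by rewrite mod_r -ltNge ltr_pdivlMr // mul1r.
have prodAB : \prod_(a <- A) ('X - a%:P) * \prod_(b <- B) ('X - b%:P)
    = \prod_(a <- T) ('X - a%:P).
  by rewrite !big_filter [RHS](bigID (fun a => (modulus a <= 1)%R)).
have countZ : count (fun z => (1 <= (1 - 4 * tau) * modulus z)%R)
      [seq (z - c) / r%:C | z <- Z]
    = count (fun z => (r' <= modulus (z - c))%R) Z.
  rewrite count_map; apply: eq_count => z /=; rewrite mod_r tau_r.
  have -> : r / r' * (modulus (z - c) / r) = modulus (z - c) / r'.
    by field; rewrite !gt_eqF.
  by rewrite ler_pdivlMr // mul1r.
have := HM A B [seq (z - c) / r%:C | z <- Z].
rewrite prodAB sizeAB size_map sizeB countZ.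
apply => //.
- by move=> a; rewrite mem_filter => /andP[].
- by move=> b; rewrite mem_filter -ltNge => /andP[].
- exact: deriv_prod_XsubC_affine.
Qed.

End Roots.

(** * Separating a bounded convex set from far points by finitely many discs *)

Section Cover.
Variable R : realType.
Implicit Types (z w v x y c : R[i]) (D : set R[i]^o).

Lemma convex_segment D x y (t : R) : convex D -> D x -> D y -> 0 <= t <= 1 ->
  D (y + t%:C * (x - y)).
Proof.
move=> cD Dx Dy /andP[t0 t1].
have := cD x y (Itv01 t0 t1) (mem_set Dx) (mem_set Dy).
move/set_mem; rewrite /conv /=.
suff -> : (t *: (x : Rcomplex R) + unstable.onem t *: (y : Rcomplex R) : R[i])
    = y + t%:C * (x - y) by [].
case: x y {Dx Dy} => a b [c d]; apply/eqP; rewrite eq_complex /unstable.onem /=.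
by apply/andP; split; apply/eqP; ring.
Qed.

Lemma bounded_set_modulus D : bounded_set D ->
  exists2 L : R, 0 < L & forall w, D w -> modulus w <= L.
Proof.
move=> [M [/RRe_real M_real HM]].
exists (`|complex.Re M| + 1); first by rewrite ltr_wpDl.
move=> w Dw; have lt_M : M < (`|complex.Re M| + 1)%:C.
  by rewrite -M_real ltcR (le_lt_trans (ler_norm _)) // ltrDl.
by have := HM _ lt_M w Dw; rewrite /= -lecR modulusE.
Qed.

Lemma sqr_modulus z :
  modulus z ^+ 2 = complex.Re z ^+ 2 + complex.Im z ^+ 2.
Proof.
by case: z => a b; rewrite /modulus /Num.norm /= sqr_sqrtr // addr_ge0 ?sqr_ge0.
Qed.

Lemma modulus_le_ReIm (a b : R) : modulus (a +i* b) <= `|a| + `|b|.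
Proof.
rewrite -(@ler_pXn2r _ 2) ?nnegrE ?modulus_ge0 ?addr_ge0 // sqr_modulus /=.
rewrite -(real_normK (num_real a)) -(real_normK (num_real b)).
have := normr_ge0 a; have := normr_ge0 b; nra.
Qed.

(** A square grid of step [h / 2] works: rounding costs at most [h / 2] in each coordinate. *)
Lemma finite_net (B h : R) : 0 < h ->
  exists s : seq R[i], forall z, modulus z <= B ->
    exists2 g, g \in s & modulus (z - g) <= h.
Proof.
move=> h0; pose k := h / 2; have k0 : 0 < k by rewrite divr_gt0.
pose N := (Num.truncn (2 * B / k)).+1.
exists [seq (i%:R * k - B) +i* (j%:R * k - B) | i <- iota 0 N, j <- iota 0 N].
move=> [a b] le_B.
have [aB bB] : `|a| <= B /\ `|b| <= B.
  split; first exact: le_trans (Re_le_modulus _) le_B.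
  apply: le_trans le_B; rewrite -(@ler_pXn2r _ 2) ?nnegrE ?modulus_ge0 //.
  by rewrite sqr_modulus real_normK ?num_real // lerDr sqr_ge0.
have round (x : R) : `|x| <= B ->
    exists2 i, i \in iota 0 N & `|x - (i%:R * k - B)| <= k.
  move=> /ler_normlP[xl xr].
  have x0 : 0 <= (x + B) / k by rewrite divr_ge0 ?(ltW k0) //; lra.
  exists (Num.truncn ((x + B) / k)).
    rewrite mem_iota add0n ltnS; apply: le_truncn.
    by rewrite ler_pM2r ?invr_gt0 //; lra.
  have /andP[] := truncn_itv x0; rewrite ler_pdivlMr // ltr_pdivrMr //.
  rewrite -natr1 [(_ + 1) * _]mulrDl mul1r => il iu; rewrite ler_norml;
    apply/andP; split; lra.
have [i iN ai] := round a aB; have [j jN bj] := round b bB.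
exists ((i%:R * k - B) +i* (j%:R * k - B)); first exact: allpairs_f.
by apply: le_trans (modulus_le_ReIm _ _) _; rewrite /k in ai bj *; lra.
Qed.

(* The disc is large, with its center far behind an almost nearest point of [D]
   to [g]. *)
Lemma disc_separation D (L : R) (g : R[i]) (d : R) :
  convex D -> D !=set0 -> (forall w, D w -> modulus w <= L) -> 0 < L ->
  0 < d -> (forall w, D w -> d <= modulus (g - w)) ->
  exists c r, [/\ 0 < r, forall w, D w -> modulus (w - c) <= r
                & r + d / 2 <= modulus (g - c)].
Proof.
move=> cD [y0 Dy0] le_L L0 d0 far_g.
pose dot u v : R := complex.Re u * complex.Re v + complex.Im u * complex.Im v.
have sqrD u v (t : R) : modulus (u + t%:C * v) ^+ 2
    = modulus u ^+ 2 + 2 * t * dot u v + t ^+ 2 * modulus v ^+ 2.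
  by rewrite !sqr_modulus /dot; case: u v => a b [a' b'] /=; ring.
(* [W] bounds the squared diameter of [D]; [t] is a step along segments of [D] small enough for
   [t * W <= sg]. *)
pose W := 4 * L ^+ 2; have W0 : 0 < W by rewrite mulr_gt0 // exprn_gt0.
pose sg := d ^+ 2 / 4; have sg0 : 0 < sg by rewrite divr_gt0 // exprn_gt0.
pose t := sg / (W + sg); have Wsg : 0 < W + sg by rewrite addr_gt0.
have t0 : 0 < t by rewrite divr_gt0.
have t1 : t <= 1 by rewrite ler_pdivrMr //; lra.
have tW : t * W <= sg.
  by rewrite mulrAC ler_pdivrMr //; nra.
pose E : set R := [set modulus (g - w) ^+ 2 | w in D].
have E_inf : has_inf E.
  split; first by exists (modulus (g - y0) ^+ 2), y0.
  by exists 0 => _ [w _ <-]; exact: sqr_ge0.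
(* [D] need not be closed, so [y] only minimizes the squared distance to [g] up to [t * sg]. *)
have [_ [y Dy <-] lt_y] := inf_adherent (mulr_gt0 t0 sg0) E_inf.
have min_y w : D w -> modulus (g - y) ^+ 2 <= modulus (g - w) ^+ 2 + t * sg.
  move=> Dw; apply: ltW; apply: lt_le_trans lt_y _; rewrite lerD2r.
  by apply: ge_inf; [case: E_inf | exists w].
have yw w : D w -> modulus (w - y) ^+ 2 <= W.
  move=> Dw; have -> : W = (2 * L) ^+ 2 by rewrite /W; ring.
  rewrite ler_pXn2r ?nnegrE ?modulus_ge0 ?mulr_ge0 ?(ltW L0) //.
  apply: le_trans (modulus_subD _ _) _; have := le_L w Dw; have := le_L y Dy;
    lra.
(* Moving from [y] towards [w] by the fraction [t] gains at most [t * sg]; expanding the square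
   gives [2 * t * dot <= t ^+ 2 * W + t * sg]. *)
have dot_le w : D w -> dot (w - y) (g - y) <= sg.
  move=> Dw; have := min_y _ (convex_segment cD Dw Dy _).
  move=> /(_ t); rewrite (ltW t0) t1 => /(_ isT).
  have -> : g - (y + t%:C * (w - y)) = (g - y) + (- t)%:C * (w - y).
    by rewrite rmorphN; ring.
  rewrite sqrD.
  have -> : dot (g - y) (w - y) = dot (w - y) (g - y) by rewrite /dot; ring.
  have := yw w Dw; have := sqr_ge0 (modulus (w - y)).
  move: (dot _ _) (modulus (g - y) ^+ 2) (modulus (w - y) ^+ 2) => p n1 n n0 nW
    min_t.
  have tnW := ler_wpM2l (sqr_ge0 t) nW; have ttW := ler_wpM2l (ltW t0) tW.
  rewrite -(ler_pM2l t0); rewrite sqrrN in min_t; rewrite !expr2 in min_t tnW;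
    lra.
(* [T] is the distance from [y] back to the center. As [W = T * d / 2], the bound
   [W + 2 * kp * sg + T ^+ 2] is at most [T ^+ 2 + T * d], below the squared radius. *)
pose T := 2 * W / d; have T0 : 0 < T by rewrite divr_gt0 // mulr_gt0.
pose q := modulus (g - y); have dq : d <= q by exact: far_g.
have q0 : 0 < q by lra.
pose kp := T / q; have kp0 : 0 < kp by rewrite divr_gt0.
have kpq : kp * q = T by rewrite /kp divfK // gt_eqF.
exists (y - kp%:C * (g - y)), (T + d / 2); split.
- by rewrite (addr_gt0 T0) ?divr_gt0.
- move=> w Dw; rewrite -(@ler_pXn2r _ 2) ?nnegrE ?modulus_ge0 //; last by lra.
  have -> : w - (y - kp%:C * (g - y)) = (w - y) + kp%:C * (g - y) by ring.
  rewrite sqrD -/q -exprMn kpq.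
  have kp_sg : kp * sg <= T * d / 4.
    have -> : T * d / 4 = kp * (q * d / 4) by rewrite -kpq; field.
    by rewrite ler_pM2l // /sg; nra.
  have Td : T * d = 2 * W by rewrite /T divfK // gt_eqF.
  have := ler_wpM2l (ltW kp0) (dot_le w Dw); have := yw w Dw; nra.
have -> : g - (y - kp%:C * (g - y)) = (1 + kp)%:C * (g - y).
  by rewrite rmorphD rmorph1; ring.
rewrite modulusM modulus_real gtr0_norm ?addr_gt0 // mulrDl mul1r kpq -/q; lra.
Qed.

(** Far out, one large centered disc is enough; on the remaining bounded region it suffices to
    separate the points of a finite [e / 4]-net, with a margin of [e / 4]. An entry holds a center,
    an inner and an outer radius. *)
Lemma disc_cover D (e : R) :
  convex D -> D !=set0 -> bounded_set D -> 0 < e ->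
  exists s : seq (R[i] * (R * R)),
    {in s, forall x : R[i] * (R * R),
      0 < x.2.1 < x.2.2 /\ forall w, D w -> modulus (w - x.1) <= x.2.1} /\
    forall z, (forall w, D w -> e <= modulus (z - w)) ->
      exists2 x : R[i] * (R * R), x \in s & x.2.2 <= modulus (z - x.1).
Proof.
move=> cD D0 /bounded_set_modulus[L L0 le_L] e0.
pose valid (x : R[i] * (R * R)) :=
  0 < x.2.1 < x.2.2 /\ forall w, D w -> modulus (w - x.1) <= x.2.1.
have valid0 : valid (0, (L, L + 1)).
  split=> /= [|w /le_L]; last by rewrite subr0.
  by rewrite L0 ltrDl ltr01.
have /choice[E HE] : forall g, exists x : R[i] * (R * R), valid x /\
    ((forall w, D w -> 3 / 4 * e <= modulus (g - w)) ->
      x.2.2 + e / 4 <= modulus (g - x.1)).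
  move=> g.
  have [far_g|near_g] :=
      pselect (forall w, D w -> 3 / 4 * e <= modulus (g - w)); last first.
    by exists (0, (L, L + 1)).
  have e34 : 0 < 3 / 4 * e by lra.
  have [c [r [r0 Dr far_c]]] := disc_separation cD D0 le_L L0 e34 far_g.
  (* Separation at distance [3 / 4 * e] leaves [3 / 8 * e] beyond [r]: [e / 8] for the enlargement
     and [e / 4] for the margin. *)
  by exists (c, (r, r + e / 8)); split=> [|_]; [split=> //=; apply/andP; split;
    lra | rewrite /=; lra].
have e4 : 0 < e / 4 by rewrite divr_gt0.
have [s Hs] := finite_net (L + 1) e4.
exists ((0, (L, L + 1)) :: [seq E g | g <- s]); split.
  move=> x; rewrite inE => /orP[/eqP -> //|/mapP[g _ ->]].
  by have [] := HE g.
move=> z far_z; have [z_far|/ltW z_near] := lerP (L + 1) (modulus z).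
  by exists (0, (L, L + 1)); rewrite ?mem_head //= subr0.
have [g gs zg] := Hs z z_near.
have [_ far_E] := HE g.
exists (E g); first by rewrite inE map_f ?orbT.
have : (E g).2.2 + e / 4 <= modulus (g - (E g).1).
  apply: far_E => w Dw; have := far_z w Dw; have := modulusD (z - g) (g - w).
  by rewrite addrA subrK; lra.
have := modulusD (g - z) (z - (E g).1); rewrite addrA subrK modulusB; lra.
Qed.

End Cover.

(** * Several discs at once, and the limit *)

Section Final.
Variable R : realType.
Implicit Types (z w a b c : R[i]) (D : set R[i]^o) (s Z : seq R[i]).

(** A union bound over the discs, by induction, taking the smallest [kappa] and the largest
    threshold. *)
Lemma few_zeros_far_from_discs (ds : seq (R[i] * (R * R))) (eta : R) :
  {in ds, forall x : R[i] * (R * R), 0 < x.2.1 < x.2.2} -> 0 < eta ->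
  exists2 kappa : R, 0 < kappa & exists M : nat, forall s Z,
    (size Z).+1 = size s ->
    (\prod_(a <- s) ('X - a%:P))^`() = (size s)%:R *:
      \prod_(z <- Z) ('X - z%:P) ->
    (M <= size s)%N ->
    (count (fun a => has (fun x => x.2.1 < modulus (a - x.1))%R ds) s)%:R
      <= kappa * (size s)%:R ->
    (count (fun z => has (fun x => x.2.2 <= modulus (z - x.1))%R ds) Z)%:R
      <= (size ds)%:R * eta * (size s)%:R.
Proof.
move=> + eta0; elim: ds => [|[c [r r']] ds IHds] valid.
  by exists 1 => //; exists 0%N => s Z *; rewrite count_pred0 !mul0r.
have [x xds | k1 k10 [M1 H1]] := IHds; first by apply: valid; rewrite inE xds orbT.
have [k2 k20 [M2 H2]] := few_zeros_far_from_disc c (valid _ (mem_head _ _))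
  eta0.
exists (Num.min k1 k2); first by rewrite lt_min k10.
exists (maxn M1 M2) => s Z sizeZ deriv_s;
  rewrite geq_max => /andP[le_M1 le_M2] le_s.
have m0 : 0 <= (size s)%:R :> R by [].
have {}H1 := H1 s Z sizeZ deriv_s le_M1.
have {}H2 := H2 s Z sizeZ deriv_s le_M2.
have le1 : (count (fun a => has (fun x => x.2.1 < modulus (a - x.1))%R ds) s)%:R
    <= k1 * (size s)%:R.
  apply: (@le_trans _ _ (Num.min k1 k2 * (size s)%:R)).
    apply: le_trans le_s; rewrite ler_nat; apply: sub_count => a /= ->.
    by rewrite orbT.
  by rewrite ler_wpM2r // ge_min lexx.
have le2 : (count (fun a => r < modulus (a - c))%R s)%:R <= k2 * (size s)%:R.
  apply: (@le_trans _ _ (Num.min k1 k2 * (size s)%:R)).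
    by apply: le_trans le_s; rewrite ler_nat; apply: sub_count => a /= ->.
  by rewrite ler_wpM2r // ge_min lexx orbT.
have := lerD (H2 le2) (H1 le1); rewrite -natrD -count_predUI natrD.
rewrite -[size (_ :: _)]/(size ds).+1 -natr1 2!mulrDl mul1r [leRHS]addrC.
by apply: le_trans; rewrite lerDl.
Qed.

Lemma notin_neighborhood D (e : R) z : D !=set0 ->
  ~ neighborhood D e z -> forall w, D w -> e <= modulus (z - w).
Proof.
move=> D0 /negP; rewrite -leNgt => le_e w Dw; apply: le_trans le_e _.
by apply: ge_inf; [exists 0 => _ [v _ <-]; exact: modulus_ge0 | exists w].
Qed.

End Final.

Theorem theorem1 (R : realType) (Omega : set R[i]^o) (p : nat -> {poly R[i]})
  (Omega_domain : domain Omega) (Omega_convex : convex Omega)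
  (Omega_bounded : bounded_set Omega)
  (deg_p : (fun n => degree (p n)) @ \oo --> \oo)
  (zeros_p : (fun n => (nzeros Omega (p n))%:R / (degree (p n))%:R : R) @ \oo
    --> (1 : R)) :
  forall e : R, 0 < e ->
    (fun n => (nzeros (neighborhood Omega e) (p n)^`())%:R
                / ((degree (p n))%:R - 1) : R) @ \oo --> (1 : R).
Proof.
move=> e e0; case: (Omega_domain) => Omega0 _ _.
have [ds [valid cover]] := disc_cover Omega_convex Omega0 Omega_bounded e0.
apply/cvgrPdist_le => eta eta0.
(* The 2 pays for [m <= 2 * (m - 1)], valid for degrees [m >= 2]; the successor keeps the divisor
   nonzero whatever [ds] is. *)
have [eta' eta'0 etaE] :
    exists2 eta', 0 < eta' & eta = eta' * (2 * (size ds).+1%:R).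
  exists (eta / (2 * (size ds).+1%:R)); first by rewrite divr_gt0 // mulr_gt0.
  by rewrite divfK // gt_eqF ?mulr_gt0.
have valid_r : {in ds, forall x : R[i] * (R * R), 0 < x.2.1 < x.2.2}.
  by move=> x /valid[].
have [kappa kappa0 [M HM]] := few_zeros_far_from_discs valid_r eta'0.
have near_M := deg_p _ (nbhs_infty_ge (maxn M 2)).
have /cvgrPdist_le/(_ _ kappa0) near_kappa := zeros_p.
near=> n.
have : (maxn M 2 <= degree (p n))%N by near: n; exact: near_M.
rewrite geq_max => /andP[le_M deg2].
have : `|1 - (nzeros Omega (p n))%:R / (degree (p n))%:R| <= kappa.
  by near: n; exact: near_kappa.
move=> le_kappa; set q := p n in le_M deg2 le_kappa *.
have q0 : q != 0.
  by apply: contraTneq deg2 => ->; rewrite /degree size_poly0.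
have lc0 : lead_coef q != 0 by rewrite lead_coef_eq0.
have [s Dq] := closed_field_poly_normal q.
have size_s : size s = degree q.
  by rewrite /degree Dq size_scale // size_prod_XsubC.
have s0 : (0 < size s)%N by rewrite size_s ltnW.
have [Z deriv_s sizeZ] := deriv_roots s0.
have m0 : 0 < (size s)%:R :> R by rewrite ltr0n.
have m2 : 2 <= (size s)%:R :> R by rewrite ler_nat size_s.
have Dq' : q^`() = (lead_coef q * (size s)%:R) *: \prod_(z <- Z) ('X - z%:P).
  by rewrite {1}Dq derivZ deriv_s scalerA.
have lcm0 : lead_coef q * (size s)%:R != 0.
  by rewrite mulf_neq0 // pnatr_eq0 -lt0n.
rewrite (nzeros_prod_XsubC _ lcm0 Dq').
move: le_kappa; rewrite (nzeros_prod_XsubC _ lc0 Dq) -size_s => le_kappa.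
(* A ratio within [kappa] of 1 means that at most [kappa * m] zeros lie outside [Omega]. *)
have few_out : (count (fun a => ~~ `[< Omega a >]) s)%:R <= kappa * (size s)%:R.
  move: le_kappa => /ler_normlP[_].
  rewrite -(ler_pM2r m0) mulrBl mul1r divfK ?gt_eqF //.
  by rewrite -{1}(count_predC (fun a => `[< Omega a >]) s) natrD addrAC subrr
    add0r.
have {}HM := HM s Z sizeZ deriv_s.
rewrite {1}size_s in HM; have {}HM := HM le_M.
(* [Omega] lies in every inner disc, so a zero outside one of them is outside [Omega]. *)
have few_s :
    (count (fun a => has (fun x => x.2.1 < modulus (a - x.1))%R ds) s)%:R
    <= kappa * (size s)%:R.
  apply: le_trans few_out; rewrite ler_nat.
  apply: sub_count => a /hasP[x xds far_a].
  apply/asboolP => Oa; have [_ /(_ a Oa)] := valid x xds.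
  by rewrite leNgt far_a.
have Z0 : 0 < (size Z)%:R :> R by rewrite ltr0n -ltnS sizeZ size_s.
have sZ : (size s)%:R = (size Z)%:R + 1 :> R by rewrite -sizeZ natr1.
rewrite sZ addrK.
set k := count _ Z.
set k' := count (fun a => ~~ `[< neighborhood Omega e a >]) Z.
have kZ : (size Z)%:R = k%:R + k'%:R :> R by rewrite -natrD count_predC.
have -> : 1 - k%:R / (size Z)%:R = k'%:R / (size Z)%:R :> R.
  have -> : k'%:R = (size Z)%:R - k%:R :> R by rewrite kZ addrC addKr.
  by rewrite mulrBl divff ?gt_eqF.
rewrite ger0_norm ?divr_ge0 // ler_pdivrMr //.
(* By [cover], a critical point outside the neighborhood is outside some enlarged disc. *)
have le_k' : k'%:R <= (size ds)%:R * eta' * (size s)%:R :> R.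
  apply: le_trans (HM few_s); rewrite ler_nat.
  apply: sub_count => z /asboolP far_z.
  have [x xds le_x] := cover z (notin_neighborhood Omega0 far_z).
  by apply/hasP; exists x.
apply: le_trans le_k' _.
rewrite etaE [_ * eta']mulrC -!mulrA ler_wpM2l ?(ltW eta'0) //.
rewrite mulrCA; apply: ler_pM => //; first by rewrite ler_nat.
lra.
Unshelve. all: by end_near.
Qed.
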